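(* Let $n\ge 2$, let $\lambda$ be a weight of $sl(n)$ with $\lambda(h_i)=\lambda_i\in\mathbb{C}$ for $i=1,\dots,n-1$, let $M_\lambda$ be the corresponding Verma module, and let $\tau:M_\lambda\to\mathcal{A}$ be the linear isomorphism and $d_1,\dots,d_{n-1}$ the differential operators on $\mathcal{A}$ described in the context. A nonzero homogeneous vector $u\in M_\lambda$ is a singular vector if and only if $$d_i(\tau(u))=0\qquad\text{for all } i=1,2,\dots,n-1.$$
   Context: All vector spaces are over $\mathbb{C}$; $\mathbb{N}=\{0,1,2,\dots\}$. Let $E_{i,j}$ be the $n\times n$ matrix unit and $h_i=E_{i,i}-E_{i+1,i+1}$ ($1\le i\le n-1$), so $H=\sum_i\mathbb{C}h_i$ is a Cartan subalgebra of $sl(n)$. Positive root vectors are $E_{i,j}$ with $i<j$, and negative root vectors are $E_{i,j}$ with $i>j$. A weight $\lambda$ is a linear function on $H$; $\lambda_i=\lambda(h_i)$. Multi-indices are $\alpha=(\alpha_{i,j})_{1\le j<i\le n}$ with $\alpha_{i,j}\in\mathbb{N}$. In the universal enveloping algebra $U(sl(n))$ put $$E^\alpha=E_{2,1}^{\alpha_{2,1}}E_{3,1}^{\alpha_{3,1}}E_{3,2}^{\alpha_{3,2}}E_{4,1}^{\alpha_{4,1}}\cdots E_{n,1}^{\alpha_{n,1}}\cdots E_{n,n-1}^{\alpha_{n,n-1}}.$$ $M_\lambda$ is the Verma module with highest weight vector $v_\lambda$ of weight $\lambda$ (so $E_{i,i+1}v_\lambda=0$ and $h_iv_\lambda=\lambda_iv_\lambda$);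 it has basis $\{E^\alpha v_\lambda\}$. A homogeneous vector is a weight vector for $H$. A singular vector is a nonzero homogeneous $u\in M_\lambda$ with $E_{i,i+1}(u)=0$ for $i=1,\dots,n-1$. $\mathcal{A}=\mathbb{C}[x_{i,j}\mid 1\le j<i\le n]$, and $\tau:M_\lambda\to\mathcal{A}$ is the linear isomorphism with $\tau(E^\alpha v_\lambda)=x^\alpha=\prod_{1\le j<i\le n}x_{i,j}^{\alpha_{i,j}}$. Write $\partial_{i,j}=\partial/\partial x_{i,j}$. For $i=1,\dots,n-1$, $$d_i=\Big(\lambda_i-\sum_{j=i+1}^n x_{j,i}\partial_{j,i}+\sum_{j=i+2}^n x_{j,i+1}\partial_{j,i+1}\Big)\partial_{i+1,i}+\sum_{j=1}^{i-1}x_{i,j}\partial_{i+1,j}-\sum_{j=i+2}^n x_{j,i+1}\partial_{j,i}.$$ *)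

(* Defs.v *)
From HB Require Import structures.
From mathcomp Require Import all_boot all_order all_algebra.
From mathcomp Require Import boolp reals.
From mathcomp.real_closed Require Import complex.
From mathcomp Require monalg.
From mathcomp Require Import mpoly.

Set Implicit Arguments.
Unset Strict Implicit.
Unset Printing Implicit Defensive.

Import GRing.Theory.
Local Open Scope ring_scope.
Local Open Scope quotient_scope.

Section SubmoduleQuotient.
Context (K : nzRingType) (V : lmodType K) (J : zmodClosed V).
Hypothesis JZ : forall (a : K) (x : V), x \in J -> a *: x \in J.

(* [JZ] is a phantom argument: it is what makes [lmod_quot] a [K]-module. *)
Definition lmod_quot of (forall (a : K) (x : V), x \in J -> a *: x \in J) :=
  Quotient.quot J.
Local Notation Q := (lmod_quot JZ).

HB.instance Definition _ := GRing.Zmodule.on Q.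

Definition lquot_pi (x : V) : Q := \pi_(Quotient.quot J) x.

Lemma lquot_piB : {morph lquot_pi : x y / x - y}.
Proof. by move=> x y; rewrite /lquot_pi !piE. Qed.

Lemma lquot_piP (x y : V) : reflect (lquot_pi x = lquot_pi y) (x - y \in J).
Proof. by rewrite Quotient.idealrBE; apply: eqP. Qed.

Definition lquot_repr (q : Q) : V := repr (q : Quotient.quot J).

Lemma lquot_reprK : cancel lquot_repr lquot_pi.
Proof. by move=> q; apply: reprK. Qed.

Lemma lquot_repr_piB (x : V) : lquot_repr (lquot_pi x) - x \in J.
Proof. by apply/lquot_piP; rewrite lquot_reprK. Qed.

Definition lquot_scale (a : K) (q : Q) : Q := lquot_pi (a *: lquot_repr q).

Lemma lquot_scaleE a x : lquot_scale a (lquot_pi x) = lquot_pi (a *: x).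
Proof. by apply/lquot_piP; rewrite -scalerBr JZ ?lquot_repr_piB. Qed.

Fact lquot_piD : {morph lquot_pi : x y / x + y}.
Proof. by move=> x y; rewrite /lquot_pi !piE. Qed.

Fact lquot_scaleA a b q : lquot_scale a (lquot_scale b q) = lquot_scale (a * b) q.
Proof. by rewrite -[q]lquot_reprK !lquot_scaleE scalerA. Qed.

Fact lquot_scale1 : left_id 1 lquot_scale.
Proof. by move=> q; rewrite -[q]lquot_reprK lquot_scaleE scale1r. Qed.

Fact lquot_scaleDr : right_distributive lquot_scale +%R.
Proof.
move=> a p q; rewrite -[p]lquot_reprK -[q]lquot_reprK.
by rewrite -lquot_piD !lquot_scaleE -lquot_piD scalerDr.
Qed.

Fact lquot_scaleDl q : {morph lquot_scale^~ q : a b / a + b}.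
Proof.
by move=> a b; rewrite -[q]lquot_reprK !lquot_scaleE -lquot_piD scalerDl.
Qed.

HB.instance Definition _ := GRing.Zmodule_isLmodule.Build K Q
  lquot_scaleA lquot_scale1 lquot_scaleDr lquot_scaleDl.

Fact lquot_pi_is_linear : linear lquot_pi.
Proof. by move=> a x y; rewrite lquot_piD -lquot_scaleE. Qed.

HB.instance Definition _ :=
  GRing.isLinear.Build K V Q *:%R lquot_pi lquot_pi_is_linear.

End SubmoduleQuotient.

Inductive left_ideal_gen (A : nzRingType) (S : A -> Prop) : A -> Prop :=
| LeftGen s of S s : left_ideal_gen S s
| LeftZero : left_ideal_gen S 0
| LeftAdd x y of left_ideal_gen S x & left_ideal_gen S y :
    left_ideal_gen S (x + y)
| LeftMul a x of left_ideal_gen S x : left_ideal_gen S (a * x).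

Inductive ideal_gen (A : nzRingType) (S : A -> Prop) : A -> Prop :=
| IdealGen s of S s : ideal_gen S s
| IdealZero : ideal_gen S 0
| IdealAdd x y of ideal_gen S x & ideal_gen S y : ideal_gen S (x + y)
| IdealMul a x b of ideal_gen S x : ideal_gen S (a * x * b).

Definition left_ideal_pred (A : nzRingType) (S : A -> Prop) : {pred A} :=
  fun x => `[< left_ideal_gen S x >].
Definition ideal_pred (A : nzRingType) (S : A -> Prop) : {pred A} :=
  fun x => `[< ideal_gen S x >].

Section GeneratedIdeals.
Context (A : nzRingType) (S : A -> Prop).

Lemma left_ideal_predP x :
  reflect (left_ideal_gen S x) (x \in left_ideal_pred S).
Proof. exact: asboolP. Qed.

Lemma ideal_predP x : reflect (ideal_gen S x) (x \in ideal_pred S).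
Proof. exact: asboolP. Qed.

Fact left_ideal_zmod_closed : zmod_closed (left_ideal_pred S).
Proof.
split; first by apply/left_ideal_predP; exact: LeftZero.
move=> x y /left_ideal_predP Jx /left_ideal_predP Jy; apply/left_ideal_predP.
by apply: LeftAdd => //; rewrite -mulN1r; apply: LeftMul.
Qed.

Fact ideal_zmod_closed : zmod_closed (ideal_pred S).
Proof.
split; first by apply/ideal_predP; exact: IdealZero.
move=> x y /ideal_predP Jx /ideal_predP Jy; apply/ideal_predP.
by apply: IdealAdd => //; rewrite -mulN1r -[_ * y]mulr1; apply: IdealMul.
Qed.

HB.instance Definition _ :=
  GRing.isZmodClosed.Build A (left_ideal_pred S) left_ideal_zmod_closed.
HB.instance Definition _ :=
  GRing.isZmodClosed.Build A (ideal_pred S) ideal_zmod_closed.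

End GeneratedIdeals.

Fact left_idealZ (K : nzRingType) (A : lalgType K) (S : A -> Prop) (a : K) x :
  x \in left_ideal_pred S -> a *: x \in left_ideal_pred S.
Proof.
move=> /left_ideal_predP Jx; apply/left_ideal_predP.
by rewrite -[x]mul1r scalerAl; apply: LeftMul.
Qed.

Fact idealZ (K : nzRingType) (A : lalgType K) (S : A -> Prop) (a : K) x :
  x \in ideal_pred S -> a *: x \in ideal_pred S.
Proof.
move=> /ideal_predP Jx; apply/ideal_predP.
by rewrite -[x]mul1r scalerAl -[_ * x]mulr1; apply: IdealMul.
Qed.

Section EnvelopingAlgebra.
Import monalg.
Context (K : comNzRingType) (L : lmodType K) (br : L -> L -> L).

Local Notation free_alg := {malg K[{fmonom L}]}.

Definition free_gen (x : L) : free_alg := << fmu x >>%R.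

(* The tensor algebra of [L] is [free_alg] modulo the relations [EnvLinear]. *)
Inductive env_rel : free_alg -> Prop :=
| EnvLinear a x y :
    env_rel (free_gen (a *: x + y) - (a *: free_gen x + free_gen y))
| EnvBracket x y :
    env_rel (free_gen x * free_gen y - free_gen y * free_gen x
             - free_gen (br x y)).

Definition env : Type := lmod_quot (@idealZ K free_alg env_rel).
HB.instance Definition _ := GRing.Lmodule.on env.

Definition env_pi : free_alg -> env := @lquot_pi _ _ _ (@idealZ _ _ env_rel).

Fact env_pi_is_linear : linear env_pi.
Proof. exact: lquot_pi_is_linear. Qed.
HB.instance Definition _ :=
  GRing.isLinear.Build K free_alg env *:%R env_pi env_pi_is_linear.

Definition env_repr : env -> free_alg :=
  @lquot_repr _ _ _ (@idealZ _ _ env_rel).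

Definition env_one : env := env_pi 1.
Definition env_mul (x y : env) : env := env_pi (env_repr x * env_repr y).

Fact env_reprK : cancel env_repr env_pi.
Proof. exact: lquot_reprK. Qed.

Fact env_piP x y : reflect (env_pi x = env_pi y) (x - y \in ideal_pred env_rel).
Proof. exact: lquot_piP. Qed.

Fact env_mulE x y : env_mul (env_pi x) (env_pi y) = env_pi (x * y).
Proof.
apply/env_piP; set x' := env_repr _; set y' := env_repr _.
have -> : x' * y' - x * y = 1 * (x' - x) * y' + x * (y' - y) * 1.
  by rewrite mul1r mulr1 mulrBl mulrBr addrA subrK.
have Ix : ideal_gen env_rel (x' - x) by apply/ideal_predP/lquot_repr_piB.
have Iy : ideal_gen env_rel (y' - y) by apply/ideal_predP/lquot_repr_piB.
by apply/ideal_predP/IdealAdd; apply: IdealMul.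
Qed.

Fact env_mulA : associative env_mul.
Proof.
move=> x y z; rewrite -[x]env_reprK -[y]env_reprK -[z]env_reprK.
by rewrite !env_mulE mulrA.
Qed.

Fact env_mul1 : left_id env_one env_mul.
Proof. by move=> x; rewrite -[x]env_reprK env_mulE mul1r. Qed.

Fact env_mulr1 : right_id env_one env_mul.
Proof. by move=> x; rewrite -[x]env_reprK env_mulE mulr1. Qed.

Fact env_mulDl : left_distributive env_mul +%R.
Proof.
move=> x y z; rewrite -[x]env_reprK -[y]env_reprK -[z]env_reprK.
by rewrite -raddfD !env_mulE -raddfD mulrDl.
Qed.

Fact env_mulDr : right_distributive env_mul +%R.
Proof.
move=> x y z; rewrite -[x]env_reprK -[y]env_reprK -[z]env_reprK.
by rewrite -raddfD !env_mulE -raddfD mulrDr.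
Qed.

(* The constant coefficient vanishes on the ideal of relations. *)
Fact env_one_neq0 : env_one != 0.
Proof.
apply/eqP; rewrite -(raddf0 env_pi) => /env_piP; rewrite subr0 => /ideal_predP.
suff coef0 (z : free_alg) : ideal_gen env_rel z -> mcoeff (@mone {fmonom L}) z = 0.
  by move/coef0/eqP; rewrite mcoeff1 eqxx oner_eq0.
have gen0 x : mcoeff (@mone {fmonom L}) (free_gen x) = 0.
  by rewrite mcoeffU1 -val_eqE /= fmU fm1.
elim=> [_ [a x y|x y]| |x y _ IHx _ IHy|a x b _ IHx].
- by rewrite !(mcoeffB, mcoeffD, mcoeffZ) !gen0 mulr0 addr0 subr0.
- by rewrite !mcoeffB !rmorphM /= !gen0 mulr0 !subr0.
- exact: mcoeff0.
- by rewrite mcoeffD IHx IHy addr0.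
- by rewrite !rmorphM /= IHx mulr0 mul0r.
Qed.

HB.instance Definition _ := GRing.Zmodule_isNzRing.Build env
  env_mulA env_mul1 env_mulr1 env_mulDl env_mulDr env_one_neq0.

Fact env_piM : {morph env_pi : x y / x * y}.
Proof. by move=> x y; rewrite -env_mulE. Qed.

Fact env_piZ a : {morph env_pi : x / a *: x}.
Proof. exact: linearZZ. Qed.

Fact env_scalerAl (a : K) (x y : env) : a *: (x * y) = (a *: x) * y.
Proof.
rewrite -[x]env_reprK -[y]env_reprK -env_piM -!env_piZ -env_piM.
by rewrite -scalerAl.
Qed.

HB.instance Definition _ := GRing.Lmodule_isLalgebra.Build K env env_scalerAl.

Fact env_scalerAr (a : K) (x y : env) : a *: (x * y) = x * (a *: y).
Proof.
rewrite -[x]env_reprK -[y]env_reprK -env_piM -!env_piZ -env_piM.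
set u := env_repr x; set v := env_repr y; congr (env_pi _).
have commC (g : free_alg) : a *: g = g * malgC a.
  rewrite -mul_malgC !malgM_def fgmulUg fgmulgU.
  by apply: eq_bigr => k _; rewrite mul1m mulm1 mulrC.
by rewrite !commC mulrA.
Qed.

HB.instance Definition _ := GRing.Lalgebra_isAlgebra.Build K env env_scalerAr.

Definition env_inj (x : L) : env := env_pi (free_gen x).

Lemma env_inj_is_linear : linear env_inj.
Proof.
move=> a x y; rewrite /env_inj -linearP; apply/env_piP/ideal_predP.
exact/IdealGen/EnvLinear.
Qed.
HB.instance Definition _ :=
  GRing.isLinear.Build K L env *:%R env_inj env_inj_is_linear.

Lemma env_inj_br x y :
  env_inj (br x y) = env_inj x * env_inj y - env_inj y * env_inj x.
Proof.
rewrite /env_inj -!env_piM -raddfB; apply/esym/env_piP/ideal_predP.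
exact/IdealGen/EnvBracket.
Qed.

End EnvelopingAlgebra.

Section SpecialLinear.
Local Open Scope complex_scope.
Context (R : realType) (n : nat).
Local Notation C := R[i].

Definition sl : {vspace 'M[C]_n} := lker (linfun (mxtrace : 'M[C]_n -> C^o)).

Lemma mem_sl (A : 'M[C]_n) : (A \in sl) = (\tr A == 0).
Proof. by rewrite memv_ker lfunE. Qed.

Definition sl_br (x y : subvs_of sl) : subvs_of sl :=
  vsproj sl (vsval x *m vsval y - vsval y *m vsval x).

Lemma sl_brE x y : vsval (sl_br x y) = vsval x *m vsval y - vsval y *m vsval x.
Proof. by rewrite vsprojK // mem_sl raddfB /= mxtrace_mulC subrr. Qed.

Definition Usl := env sl_br.
HB.instance Definition _ := GRing.Algebra.on Usl.

(* The class in [Usl] of a traceless matrix (junk if [\tr A != 0]). *)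
Definition usl (A : 'M[C]_n) : Usl := env_inj sl_br (vsproj sl A).

(* The elements [i] and [i + 1] of ['I_n], for [i : 'I_n.-1]. *)
Definition ord_lo (i : 'I_n.-1) : 'I_n := widen_ord (leq_pred n) i.
Fact ord_hi_subproof (i : 'I_n.-1) : (i.+1 < n)%N.
Proof. by rewrite -ltn_predRL. Qed.
Definition ord_hi (i : 'I_n.-1) : 'I_n := Ordinal (ord_hi_subproof i).

Definition hmx (i : 'I_n.-1) : 'M[C]_n :=
  delta_mx (ord_lo i) (ord_lo i) - delta_mx (ord_hi i) (ord_hi i).

Definition cartan : {vspace 'M[C]_n} := <<[seq hmx i | i : 'I_n.-1]>>%VS.

Lemma cartan_sub_sl : (cartan <= sl)%VS.
Proof.
apply/span_subvP => _ /imageP[i _ ->].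
have trE k : \tr (delta_mx k k : 'M[C]_n) = 1.
  rewrite /mxtrace (bigD1 k) //= mxE eqxx big1 ?addr0 // => l /negPf neq_lk.
  by rewrite mxE neq_lk.
by rewrite mem_sl raddfB /= !trE subrr.
Qed.

Definition weight := 'Hom(subvs_of cartan, C^o).

Definition wt_coord (lam : weight) (i : 'I_n.-1) : C :=
  lam (vsproj cartan (hmx i)).

Inductive verma_rel (lam : weight) : Usl -> Prop :=
| VermaPos (i j : 'I_n) of (i < j)%N : verma_rel lam (usl (delta_mx i j))
| VermaCartan (h : subvs_of cartan) :
    verma_rel lam (usl (vsval h) - (lam h : C)%:A).

Definition verma (lam : weight) : Type :=
  lmod_quot (@left_idealZ C Usl (verma_rel lam)).
HB.instance Definition _ lam := GRing.Lmodule.on (verma lam).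

Section Verma.
Context (lam : weight).

Definition verma_pi : Usl -> verma lam :=
  @lquot_pi _ _ _ (@left_idealZ _ _ (verma_rel lam)).

Definition verma_repr : verma lam -> Usl :=
  @lquot_repr _ _ _ (@left_idealZ _ _ (verma_rel lam)).

Lemma verma_reprK : cancel verma_repr verma_pi.
Proof. exact: lquot_reprK. Qed.

Fact verma_pi_is_linear : linear verma_pi.
Proof. exact: lquot_pi_is_linear. Qed.
HB.instance Definition _ :=
  GRing.isLinear.Build C Usl (verma lam) *:%R verma_pi verma_pi_is_linear.

Definition verma_act (x : Usl) (u : verma lam) : verma lam :=
  verma_pi (x * verma_repr u).

Lemma verma_actE x y : verma_act x (verma_pi y) = verma_pi (x * y).
Proof.
apply/lquot_piP; rewrite -mulrBr; apply/left_ideal_predP/LeftMul.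
exact/left_ideal_predP/lquot_repr_piB.
Qed.

Definition verma_vec : verma lam := verma_pi 1.

Lemma verma_vec_pos (i j : 'I_n) :
  (i < j)%N -> verma_act (usl (delta_mx i j)) verma_vec = 0.
Proof.
move=> lt_ij; rewrite verma_actE mulr1 -(raddf0 verma_pi).
apply/lquot_piP; rewrite subr0; apply/left_ideal_predP.
exact/LeftGen/VermaPos.
Qed.

Lemma verma_vec_wt (h : subvs_of cartan) :
  verma_act (usl (vsval h)) verma_vec = (lam h : C) *: verma_vec.
Proof.
rewrite verma_actE mulr1 /verma_vec -linearZZ.
by apply/lquot_piP/left_ideal_predP; apply/LeftGen/VermaCartan.
Qed.

Definition homogeneous (u : verma lam) : Prop :=
  exists mu : weight, forall h : subvs_of cartan,
    verma_act (usl (vsval h)) u = (mu h : C) *: u.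

Definition singular (u : verma lam) : Prop :=
  [/\ u != 0, homogeneous u &
      forall i : 'I_n.-1,
        verma_act (usl (delta_mx (ord_lo i) (ord_hi i))) u = 0].

End Verma.

Definition lpair := {p : 'I_n * 'I_n | (p.2 < p.1)%N}.

Definition polA := {mpoly C[#|{: lpair}|]}.
HB.instance Definition _ := GRing.ComAlgebra.on polA.

(* Position of x_{i,j} among the variables of [polA]; [None] unless
   [j < i], so that the default values below only concern absent variables. *)
Definition vidx (i j : 'I_n) : option 'I_#|{: lpair}| :=
  omap enum_rank (insub (i, j) : option lpair).

Definition xvar (i j : 'I_n) : polA :=
  if vidx i j is Some k then 'X_k else 0.

Definition dvar (i j : 'I_n) (p : polA) : polA :=
  if vidx i j is Some k then mderiv k p else 0.

Definition expo (alpha : 'X_{1..#|{: lpair}|}) (i j : 'I_n) : nat :=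
  if vidx i j is Some k then alpha k else 0.

(* Both products are non-commutative: rows are in increasing order and, within
   a row, columns are in increasing order. *)
Definition Epow (alpha : 'X_{1..#|{: lpair}|}) : Usl :=
  \prod_(i < n) \prod_(j < n | (j < i)%N) usl (delta_mx i j) ^+ expo alpha i j.

Definition xpow (alpha : 'X_{1..#|{: lpair}|}) : polA :=
  \prod_(i < n) \prod_(j < n | (j < i)%N) xvar i j ^+ expo alpha i j.

Definition dop (lam : weight) (i : 'I_n.-1) (p : polA) : polA :=
  let a := ord_lo i in let b := ord_hi i in
  let q := dvar b a p in
  (wt_coord lam i *: q
   - \sum_(j < n | (a < j)%N) xvar j a * dvar j a q
   + \sum_(j < n | (b < j)%N) xvar j b * dvar j b q)
  + \sum_(j < n | (j < a)%N) xvar a j * dvar b j p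
  - \sum_(j < n | (b < j)%N) xvar j b * dvar j a p.

End SpecialLinear.

(* Main.v *)
Require Import Defs.
From HB Require Import structures.
From mathcomp Require Import all_boot all_order all_algebra.
From mathcomp Require Import reals.
From mathcomp.real_closed Require Import complex.
From mathcomp Require Import mpoly.
From mathcomp Require Import ring zify.
Import GRing.Theory.
Local Open Scope ring_scope.
Local Open Scope complex_scope.

Set Implicit Arguments.
Unset Strict Implicit.
Unset Printing Implicit Defensive.

(* With X the inverse of tau, one shows E_{i,i+1} X(p) = X(d_i p) for every
   polynomial p, by induction on monomials, removing the first variable x_{k,l}
   in the order of the factors of E^alpha.  As long as E_{k,l} commutes with all
   the earlier root vectors that occur, E_{k,l} X(p) = X(x_{k,l} p); this covers
   every term of d_i applied to a monomial that starts at x_{k,l} or later.  It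
   remains to match [E_{i,i+1}, E_{k,l}], which is 0, h_i or up to sign another
   negative root vector, with the commutator of d_i and x_{k,l}. *)

(** * General facts: ordered products, linear maps out of polynomials *)

Lemma mulr_prod_ord (A : pzSemiRingType) (n : nat) (P : pred 'I_n)
    (F F' : 'I_n -> A) (k : 'I_n) (c : A) :
    P k ->
    (forall i, P i -> (i < k)%N -> GRing.comm c (F i)) ->
    c * F k = F' k ->
    (forall i, P i -> i != k -> F i = F' i) ->
  c * \prod_(i < n | P i) F i = \prod_(i < n | P i) F' i.
Proof.
move=> Pk cF cFk FF'.
(* The enumeration of ['I_n] is increasing, so the factors met before index [k] have smaller index
   and commute with [c]. *)
have : pairwise (fun i j : 'I_n => i < j)%N (index_enum 'I_n).
  rewrite -[pairwise _ _](pairwise_map val ltn) [index_enum _]unlock -enumT val_enum_ord.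
  by rewrite -(sorted_pairwise ltn_trans) iota_ltn_sorted.
have := mem_index_enum k.
elim: (index_enum _) => // i r IH; rewrite inE /= => kr /andP[/allP ir pr].
rewrite !big_cons; case: eqVneq kr => [ik _|ki /= kr].
  rewrite -ik Pk mulrA cFk [in LHS]big_seq_cond [in RHS]big_seq_cond.
  congr (_ * _); apply: eq_bigr => j /andP[jr Pj]; apply: FF' => //.
  by move: (ir j jr); rewrite -ik; case: eqVneq => [->|//]; rewrite ltnn.
case: ifP => Pi; last exact: IH.
by rewrite mulrA (cF i Pi (ir k kr)) -mulrA IH // FF' // eq_sym.
Qed.

Lemma mpoly_linear_ext (n : nat) (K : nzRingType) (W : lmodType K)
    (f g : {mpoly K[n]} -> W) :
  linear f -> linear g -> (forall m, f 'X_[m] = g 'X_[m]) -> f =1 g.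
Proof.
move=> f_lin g_lin fg; have lin0 (t : {mpoly K[n]} -> W) : linear t -> t 0 = 0.
  by move=> t_lin; have := t_lin (-1) 0 0; rewrite scaler0 addr0 scaleN1r addNr.
elim/mpolyind => [|t m q _ _ IH]; first by rewrite !lin0.
by rewrite f_lin g_lin fg IH.
Qed.

(** * Variables, exponents and ordered monomials *)

Section Coordinates.
Context (R : realType) (n : nat).
Local Notation C := R[i].
Local Notation N := #|{: lpair n}|.
Implicit Types (m : 'X_{1..N}) (i j k l r s : 'I_n) (p q : polA R n).

Lemma vidx_lt k l : (l < k)%N -> exists c, vidx k l = Some c.
Proof.
move=> lk.
by rewrite /vidx (insubT (fun p : 'I_n * 'I_n => p.2 < p.1)%N (x := (k, l)) lk); eexists.
Qed.

Lemma vidx_inj k l r s c :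
  vidx k l = Some c -> vidx r s = Some c -> (r, s) = (k, l).
Proof.
rewrite /vidx; case: insubP => //= t _ <- [<-].
by case: insubP => //= t' _ <- [/enum_rank_inj ->].
Qed.

Lemma vidx_ge k l : (k <= l)%N -> vidx k l = None.
Proof. by move=> kl; rewrite /vidx insubF //= ltnNge kl. Qed.

Lemma vidx_surj c : exists k l, (l < k)%N /\ vidx k l = Some c.
Proof.
case: (enum_val c) (enum_valK c) => -[k l] /= lk <-; exists k, l; split=> //.
by rewrite /vidx (insubT (fun p : 'I_n * 'I_n => p.2 < p.1)%N (x := (k, l)) lk).
Qed.

(** The default 0 is harmless in [dvarX], which holds for every pair: for an absent variable both
    [expo] and [dvar] vanish. *)
Definition mnm_pair k l : 'X_{1..N} :=
  if vidx k l is Some c then U_(c)%MM else 0%MM.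

Lemma expo_ge m k l : (k <= l)%N -> expo m k l = 0%N.
Proof. by move=> kl; rewrite /expo vidx_ge. Qed.

Lemma expo0 k l : expo 0%MM k l = 0%N.
Proof. by rewrite /expo; case: vidx => // c; rewrite mnm0E. Qed.

Lemma expoD m m' k l : expo (m + m')%MM k l = (expo m k l + expo m' k l)%N.
Proof. by rewrite /expo; case: vidx => // c; rewrite mnmDE. Qed.

Lemma expoB m m' k l : expo (m - m')%MM k l = (expo m k l - expo m' k l)%N.
Proof. by rewrite /expo; case: vidx => // c; rewrite mnmBE. Qed.

Lemma expo_pair k l r s : (l < k)%N ->
  expo (mnm_pair k l) r s = ((r, s) == (k, l)).
Proof.
move=> /vidx_lt[c kl]; rewrite /expo /mnm_pair kl.
case: eqP => [[-> ->]|neq]; first by rewrite kl mnm1E eqxx.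
case rs: vidx => [d|//]; rewrite mnm1E; case: eqP => // cd; case: neq.
by apply: (vidx_inj kl); rewrite cd.
Qed.

Lemma xvarE k l : (l < k)%N -> xvar R k l = 'X_[mnm_pair k l].
Proof. by move=> /vidx_lt[c kl]; rewrite /xvar /mnm_pair kl. Qed.

Lemma xvarX k l m : (l < k)%N ->
  xvar R k l * 'X_[m] = 'X_[(mnm_pair k l + m)%MM].
Proof. by move=> lk; rewrite xvarE // mpolyXD. Qed.

Lemma dvarX k l m :
  dvar k l ('X_[m] : polA R n) = (expo m k l)%:R *: 'X_[(m - mnm_pair k l)%MM].
Proof.
rewrite /dvar /expo /mnm_pair; case: vidx => [c|]; first by rewrite mderivX.
by rewrite scale0r.
Qed.

Lemma dvar_is_linear k l : linear (@dvar R n k l).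
Proof.
move=> a p q; rewrite /dvar; case: vidx => [c|]; first exact: mderiv_is_linear.
by rewrite scaler0 addr0.
Qed.
HB.instance Definition _ k l :=
  GRing.isLinear.Build C (polA R n) (polA R n) *:%R (dvar k l)
    (dvar_is_linear k l).

Lemma dvar_xvarM i j k l p : (l < k)%N ->
  dvar i j (xvar R k l * p) =
    ((i, j) == (k, l))%:R *: p + xvar R k l * dvar i j p.
Proof.
move=> lk; rewrite -expo_pair //; have [c kl] := vidx_lt lk.
rewrite {1}/dvar /expo /xvar /mnm_pair kl.
rewrite /dvar; case ij: vidx => [d|]; last by rewrite mulr0 scale0r addr0.
rewrite mderivM mderivX; congr (_ + _).
rewrite -scalerAl mnm1E; case: eqP => [->|_]; last by rewrite !scale0r.
by rewrite -[X in (X - _)%MM]add0m addmK mpolyX0 mul1r.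
Qed.

(* The order of the factors of [Epow]. *)
Definition lex_le (k l r s : 'I_n) := (k < r)%N || (k == r) && (l <= s)%N.

(** For such [m], putting a factor of index (k,l) in front of the ordered product requires no
    reordering. *)
Definition lex_supp k l m := forall r s, expo m r s != 0%N -> lex_le k l r s.

Lemma lex_suppB k l m m' : lex_supp k l m -> lex_supp k l (m - m')%MM.
Proof.
by move=> sm r s; rewrite expoB => ne; apply: sm; apply: contraNneq ne => ->.
Qed.

(** Take [k] the least row occurring in [m] and [l] the least column occurring in that row: removing
    one x_{k,l} lowers the degree and leaves nothing before x_{k,l}. *)
Lemma mpolyX_ind (P : 'X_{1..N} -> Prop) :
    P 0%MM ->
    (forall k l m, (l < k)%N -> lex_supp k l m -> P m ->
      P (mnm_pair k l + m)%MM) ->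
  forall m, P m.
Proof.
move=> P0 PS m; have [d] := ubnP (mdeg m).
elim: d m => // d IH m; rewrite ltnS => dm.
have [/eqP|] := eqVneq (mdeg m) 0%N; first by rewrite mdeg_eq0 => /eqP ->.
rewrite mdegE sum_nat_eq0 => /forallPn[/= c].
have [k0 [l0 [_ kl0]]] := vidx_surj c; move=> mc.
have ex_k : [exists l, expo m k0 l != 0%N].
  by apply/existsP; exists l0; rewrite /expo kl0.
case: (@arg_minnP _ k0 (fun k => [exists l, expo m k l != 0%N]) val ex_k) =>
  k /existsP[l1 ml1] kmin.
case: (@arg_minnP _ l1 (fun l => expo m k l != 0%N) val ml1) => l mkl lmin.
have lk : (l < k)%N.
  by case: ltnP mkl => // kl; rewrite expo_ge.
have [c' klc] := vidx_lt lk.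
have mE : (mnm_pair k l + (m - mnm_pair k l) = m)%MM.
  rewrite addmC submK // /mnm_pair klc; apply/mnm_lepP => b.
  by rewrite mnm1E; case: eqP => // <-; move: mkl; rewrite /expo klc lt0n.
rewrite -mE; apply: PS => // [r s|].
  rewrite expoB => ne; have : expo m r s != 0%N by apply: contraNneq ne => ->.
  move=> mrs; rewrite /lex_le; have : (k <= r)%N.
    by apply: kmin; apply/existsP; exists s.
  rewrite leq_eqVlt => /orP[/eqP/val_inj kr|->//]; subst r.
  by rewrite eqxx lmin ?orbT.
apply: IH; apply: leq_trans dm; rewrite -[X in (_ < mdeg X)%N]mE mdegD.
by rewrite {2}/mnm_pair klc mdeg1.
Qed.

(** Common shape of [Epow], where [g] gives the root vectors, and of [xpow], where it gives the
    variables. *)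
Definition ordered_monomial (A : pzSemiRingType) (g : 'I_n -> 'I_n -> A) m : A :=
  \prod_(i < n) \prod_(j < n | (j < i)%N) g i j ^+ expo m i j.

(** Only the earlier factors that occur in [m] separate [g k l] from its place. [mulr_prod_ord] is
    used on the rows, then on the columns of row [k]. *)
Lemma ordered_monomialM (A : pzSemiRingType) (g : 'I_n -> 'I_n -> A) k l m :
    (l < k)%N ->
    (forall r s, (s < r)%N -> expo m r s != 0%N -> ~~ lex_le k l r s ->
      GRing.comm (g k l) (g r s)) ->
  g k l * ordered_monomial g m = ordered_monomial g (mnm_pair k l + m)%MM.
Proof.
move=> lk cg; have cgX r s : (s < r)%N -> ~~ lex_le k l r s ->
    GRing.comm (g k l) (g r s ^+ expo m r s).
  move=> sr rs; have [->|ne] := eqVneq (expo m r s) 0%N; first exact: commr1.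
  by apply: commrX; apply: cg.
apply: (mulr_prod_ord (k := k)) => // [i _ ik||i _ ik].
- apply: commr_prod => j ji; apply: cgX => //.
  by rewrite /lex_le negb_or -leqNgt ltnW //= -val_eqE gtn_eqF.
- apply: (mulr_prod_ord (k := l)) => // [j jk jl||j _ jl].
  + by apply: cgX => //; rewrite /lex_le ltnn eqxx -ltnNge.
  + by rewrite expoD expo_pair // eqxx exprS.
  + by rewrite expoD expo_pair // xpair_eqE eqxx (negPf jl).
apply: eq_bigr => j _.
by rewrite expoD expo_pair // xpair_eqE (negPf ik).
Qed.

Lemma xpowE m : xpow R m = 'X_[m].
Proof.
elim/mpolyX_ind: m => [|k l m lk _ IH].
  rewrite /xpow mpolyX0; apply: big1 => i _; apply: big1 => j _.
  by rewrite expo0.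
rewrite -xvarX // -IH; symmetry.
by apply: ordered_monomialM => // r s _ _ _; apply: mulrC.
Qed.

End Coordinates.

(* [P] with [x], [d] and [mon] stands for [polA] with [xvar], [dvar] and the
   monomials, and below [A], [V], [e] for [Usl], [verma] and the matrix units:
   unification is intractable on the concrete quotients. *)
Section WeylCalculus.
Context (n : nat) (K : comNzRingType) (P : comAlgType K) (c : K) (a b : 'I_n).
Implicit Types (j k l r s : 'I_n) (p : P).
Context (x : 'I_n -> 'I_n -> P) (d : 'I_n -> 'I_n -> {linear P -> P}).
Context (d_xM : forall (i : 'I_n) j k l p, (l < k)%N ->
  d i j (x k l * p) = ((i, j) == (k, l))%:R *: p + x k l * d i j p).

(** * Commutators of the differential operators with the variables *)

Lemma euler_xM r s k l p : (l < k)%N ->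
  x r s * d r s (x k l * p) =
    ((r, s) == (k, l))%:R *: (x k l * p) + x k l * (x r s * d r s p).
Proof.
move=> lk; rewrite d_xM // mulrDr mulrCA; congr (_ + _).
by case: eqP => [[-> ->]|_]; rewrite ?scale1r // !scale0r mulr0.
Qed.

Lemma euler_col_xM (i : 'I_n) k l p : (l < k)%N ->
  \sum_(j < n | (i < j)%N) x j i * d j i (x k l * p) =
  (i == l)%:R *: (x k l * p)
  + x k l * \sum_(j < n | (i < j)%N) x j i * d j i p.
Proof.
move=> lk; under eq_bigr do rewrite euler_xM //.
rewrite big_split -mulr_sumr; congr (_ + _).
case: (eqVneq i l) => [->|/negPf il]; last first.
  by rewrite scale0r big1 // => j _; rewrite xpair_eqE il andbF scale0r.
rewrite (bigD1 k) //= eqxx big1 ?addr0 // => j /andP[_ /negPf jk].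
by rewrite xpair_eqE jk scale0r.
Qed.

Lemma euler_row_xM (i : 'I_n) k l p : (l < k)%N ->
  \sum_(j < n | (j < i)%N) x i j * d i j (x k l * p) =
  (i == k)%:R *: (x k l * p)
  + x k l * \sum_(j < n | (j < i)%N) x i j * d i j p.
Proof.
move=> lk; under eq_bigr do rewrite euler_xM //.
rewrite big_split -mulr_sumr; congr (_ + _).
case: (eqVneq i k) => [->|/negPf ik]; last first.
  by rewrite scale0r big1 // => j _; rewrite xpair_eqE ik scale0r.
rewrite (bigD1 l) //= eqxx big1 ?addr0 // => j /andP[_ /negPf jl].
by rewrite xpair_eqE jl andbF scale0r.
Qed.

(** The parenthesised factor of d_i, with [c] for lambda_i. *)
Definition col_wtop p : P :=
  c *: p - \sum_(j < n | (a < j)%N) x j a * d j a p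
    + \sum_(j < n | (b < j)%N) x j b * d j b p.

(** The action of h_i in coordinates: each variable x_{r,s} counts with the h_i-weight of E_{r,s},
    which is +1 for row [a] and column [b], and -1 for row [b] and column [a]. *)
Definition wtop p : P :=
  col_wtop p + \sum_(j < n | (j < a)%N) x a j * d a j p
    - \sum_(j < n | (j < b)%N) x b j * d b j p.

Definition raising_op p : P :=
  col_wtop (d b a p) + \sum_(j < n | (j < a)%N) x a j * d b j p
    - \sum_(j < n | (b < j)%N) x j b * d j a p.

Let sum_mul_is_linear (Q : pred 'I_n) (y : 'I_n -> P)
    (D : 'I_n -> {linear P -> P}) t p q :
  \sum_(j < n | Q j) y j * D j (t *: p + q) =
  t *: (\sum_(j < n | Q j) y j * D j p) + \sum_(j < n | Q j) y j * D j q.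
Proof.
rewrite scaler_sumr -big_split; apply: eq_bigr => j _ /=.
by rewrite linearP mulrDr scalerAr.
Qed.

Lemma col_wtop_is_linear : linear col_wtop.
Proof.
move=> t p q; rewrite /col_wtop !(sum_mul_is_linear _ _ (fun j => d j _)).
by rewrite !scalerDr scalerN !scalerA [c * t]mulrC; ring.
Qed.
HB.instance Definition _ :=
  GRing.isLinear.Build K P P *:%R col_wtop col_wtop_is_linear.

Lemma raising_op_is_linear : linear raising_op.
Proof.
move=> t p q; rewrite /raising_op !linearP /= (sum_mul_is_linear _ _ (d b)).
by rewrite (sum_mul_is_linear _ _ (fun j => d j a)) !scalerDr scalerN; ring.
Qed.

Lemma col_wtop_xM k l p : (l < k)%N ->
  col_wtop (x k l * p) =
  x k l * col_wtop p + ((b == l)%:R - (a == l)%:R) *: (x k l * p).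
Proof.
move=> lk; rewrite /col_wtop !euler_col_xM // !mulrDr mulrN -scalerAr scalerBl.
by ring.
Qed.

Lemma wtop_xM k l p : (l < k)%N ->
  wtop (x k l * p) = x k l * wtop p
  + ((a == k)%:R - (a == l)%:R - (b == k)%:R + (b == l)%:R) *: (x k l * p).
Proof.
move=> lk; rewrite /wtop col_wtop_xM // !euler_row_xM //.
by rewrite !scalerDl !scaleNr; ring.
Qed.

(** The first, third and fourth corrections reflect the values h_i, E_{a,l} and -E_{k,b} of
    [E_{a,b}, E_{k,l}]. The second comes from moving x_{k,l} out of [col_wtop]; on monomials
    starting at x_{k,l} or later it completes the first to [wtop], or vanishes. *)
Lemma raising_op_xM k l p : (l < k)%N ->
  raising_op (x k l * p) =
  x k l * raising_op p
  + (((b, a) == (k, l))%:R *: col_wtop p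
  + ((b == l)%:R - (a == l)%:R) *: (x k l * d b a p)
  + ((b == k) && (l < a)%N)%:R *: (x a l * p)
  - ((a == l) && (b < k)%N)%:R *: (x k b * p)).
Proof.
move=> lk; rewrite /raising_op d_xM // linearP /= col_wtop_xM //.
(* The product rule adds a term only at [j = l], when [k = b] and [l < a]. *)
have -> : \sum_(j < n | (j < a)%N) x a j * d b j (x k l * p) =
    ((b == k) && (l < a)%N)%:R *: (x a l * p)
    + x k l * \sum_(j < n | (j < a)%N) x a j * d b j p.
  under eq_bigr do rewrite d_xM // mulrDr mulrCA.
  rewrite big_split -mulr_sumr; congr (_ + _).
  case: (boolP (_ && _)) => [/andP[/eqP <- la]|ne]; last first.
    rewrite scale0r; apply: big1 => j ja; case: eqP => [[bk jl]|_].
      by rewrite -bk -jl eqxx ja in ne.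
    by rewrite scale0r mulr0.
  rewrite (bigD1 l) //= eqxx !scale1r big1 ?addr0 // => j /andP[_ /negPf jl].
  by rewrite xpair_eqE jl andbF scale0r mulr0.
(* Here it adds a term only at [j = k], when [l = a] and [b < k]. *)
have -> : \sum_(j < n | (b < j)%N) x j b * d j a (x k l * p) =
    ((a == l) && (b < k)%N)%:R *: (x k b * p)
    + x k l * \sum_(j < n | (b < j)%N) x j b * d j a p.
  under eq_bigr do rewrite d_xM // mulrDr mulrCA.
  rewrite big_split -mulr_sumr; congr (_ + _).
  case: (boolP (_ && _)) => [/andP[/eqP <- bk]|ne]; last first.
    rewrite scale0r; apply: big1 => j bj; case: eqP => [[jk al]|_].
      by rewrite -al -jk eqxx bj in ne.
    by rewrite scale0r mulr0.
  rewrite (bigD1 k) //= eqxx !scale1r big1 ?addr0 // => j /andP[_ /negPf jk].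
  by rewrite xpair_eqE jk scale0r mulr0.
by ring.
Qed.

Context (mon : 'X_{1..#|{: lpair n}|} -> P).
Context (mon0 : mon 0%MM = 1).
Context (x_mon : forall k l m, (l < k)%N ->
  x k l * mon m = mon (mnm_pair k l + m)%MM).
Context (d_mon : forall k l m,
  d k l (mon m) = (expo m k l)%:R *: mon (m - mnm_pair k l)%MM).
Context (ab : b = a.+1 :> nat).

Lemma d_one k l : d k l 1 = 0.
Proof. by rewrite -mon0 d_mon expo0 scale0r. Qed.

Lemma d_lex_supp k l r s m : lex_supp k l m -> ~~ lex_le k l r s ->
  d r s (mon m) = 0.
Proof.
move=> sm; have [rs _|/sm -> //] := eqVneq (expo m r s) 0%N.
by rewrite d_mon rs scale0r.
Qed.

(** No variable of [m] lies in row [a], or in row [b] before column [a]; as b = a + 1, the sum over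
    row [b] keeps only its last term, [j = a]. *)
Lemma wtop_lex_supp m : lex_supp b a m ->
  wtop (mon m) = col_wtop (mon m) - x b a * d b a (mon m).
Proof.
move=> sm; rewrite /wtop big1 ?addr0 => [|j ja]; last first.
  by rewrite (d_lex_supp sm) ?mulr0 // /lex_le -!val_eqE /=; lia.
congr (_ - _); rewrite (bigD1 a) ?ab //= big1 ?addr0 //.
move=> j /andP[jb ja]; rewrite (d_lex_supp sm) ?mulr0 //.
by move: ja jb; rewrite /lex_le -!val_eqE /=; lia.
Qed.

(** * Actions of h_i and E_{i,i+1} on a highest weight module *)

Section HighestWeightModule.
Context (A : algType K) (V : lmodType K) (act : A -> V -> V) (v : V).
Context (act_is_linear : forall y, linear (act y)).
Context (act_is_linearl : forall u, linear (act^~ u)).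
Context (actM : forall y z u, act (y * z) u = act y (act z u)).
Context (act1 : act 1 v = v).
Context (e : 'I_n -> 'I_n -> A) (h : A).
Context (e_br : forall (i : 'I_n) j k l, i != j -> k != l -> (j != k) || (l != i) ->
  e i j * e k l = e k l * e i j
    + ((j == k)%:R *: e i l - (l == i)%:R *: e k j)).
Context (e_ab_ba : e a b * e b a = e b a * e a b + h).
Context (h_br : forall k l, k != l ->
  h * e k l = e k l * h
  + ((a == k)%:R - (a == l)%:R - (b == k)%:R + (b == l)%:R) *: e k l).
Context (act_e_ab : act (e a b) v = 0) (act_h : act h v = c *: v).
Context (X : {linear P -> V}).
Context (X_mon : forall m, X (mon m) = act (ordered_monomial e m) v).

HB.instance Definition _ y :=
  GRing.isLinear.Build K V V *:%R (act y) (act_is_linear y).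

Let actDl y z u : act (y + z) u = act y u + act z u.
Proof. by have := act_is_linearl u 1 y z; rewrite !scale1r. Qed.
Let act0l u : act 0 u = 0.
Proof. by apply: (addrI (act 0 u)); rewrite -actDl !addr0. Qed.
Let actZl t y u : act (t *: y) u = t *: act y u.
Proof. by have := act_is_linearl u t y 0; rewrite act0l !addr0. Qed.

Lemma e_comm (i : 'I_n) j k l :
  i != j -> k != l -> j != k -> l != i -> GRing.comm (e i j) (e k l).
Proof.
move=> ij kl jk li; rewrite /GRing.comm e_br ?jk //.
by rewrite (negPf jk) (negPf li) !scale0r subr0 addr0.
Qed.

(* Left multiplication by [x k l] corresponds to [e k l] only where no
   reordering correction occurs. *)
Definition act_is_mul k l p := act (e k l) (X p) = X (x k l * p).

Lemma act_is_mul0 k l : act_is_mul k l 0.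
Proof. by rewrite /act_is_mul mulr0 !linear0. Qed.

Lemma act_is_mulD k l p q :
  act_is_mul k l p -> act_is_mul k l q -> act_is_mul k l (p + q).
Proof. by rewrite /act_is_mul mulrDr !linearD /= => -> ->. Qed.

Lemma act_is_mulZ k l t p : act_is_mul k l p -> act_is_mul k l (t *: p).
Proof. by rewrite /act_is_mul -scalerAr !linearZ /= => ->. Qed.

Lemma act_is_mulN k l p : act_is_mul k l p -> act_is_mul k l (- p).
Proof. by rewrite -scaleN1r; apply: act_is_mulZ. Qed.

Lemma act_is_mul_sum k l (Q : pred 'I_n) (F : 'I_n -> P) :
    (forall j, Q j -> act_is_mul k l (F j)) ->
  act_is_mul k l (\sum_(j < n | Q j) F j).
Proof. by apply: (big_ind _ (act_is_mul0 k l)); apply: act_is_mulD. Qed.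

Lemma act_is_mul_mon k l m : (l < k)%N ->
    (forall r s, (s < r)%N -> expo m r s != 0%N -> ~~ lex_le k l r s ->
      GRing.comm (e k l) (e r s)) ->
  act_is_mul k l (mon m).
Proof.
by move=> lk cm; rewrite /act_is_mul x_mon // !X_mon -actM ordered_monomialM.
Qed.

Lemma act_is_mul_lex_supp k l m :
  (l < k)%N -> lex_supp k l m -> act_is_mul k l (mon m).
Proof. by move=> lk sm; apply: act_is_mul_mon => // r s _ /sm ->. Qed.

(** The result is zero unless x_{i,j} occurs in [m], and then x_{r,s} is the only variable that can
    come before x_{k,l}; so a single commutation has to be checked. *)
Lemma act_is_mul_xd k l r s i j m : (l < k)%N -> (s < r)%N ->
    lex_supp k l m ->
    (lex_le k l i j -> ~~ lex_le k l r s -> GRing.comm (e k l) (e r s)) ->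
  act_is_mul k l (x r s * d i j (mon m)).
Proof.
move=> lk sr sm cm; rewrite d_mon -scalerAr.
have [->|ne] := eqVneq (expo m i j) 0%N.
  by rewrite scale0r; apply: act_is_mul0.
apply: act_is_mulZ; rewrite x_mon //; apply: act_is_mul_mon => // r' s' sr'.
rewrite expoD expo_pair //; case: ((r', s') =P (r, s)) => [[-> ->] _|_].
  by apply: cm; apply: sm.
by rewrite add0n => /(lex_suppB sm) le /negP[].
Qed.

(** An Euler term x_{r,s} d_{r,s} brings in no new variable: the two order conditions of
    [act_is_mul_xd] contradict each other. *)
Lemma act_is_mul_col_wtop k l m :
  (l < k)%N -> lex_supp k l m -> act_is_mul k l (col_wtop (mon m)).
Proof.
move=> lk sm; apply: act_is_mulD; first apply: act_is_mulD.
- by apply: act_is_mulZ; apply: act_is_mul_lex_supp.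
- apply: act_is_mulN; apply: act_is_mul_sum => j aj.
  by apply: act_is_mul_xd => // ->.
- by apply: act_is_mul_sum => j bj; apply: act_is_mul_xd => // ->.
Qed.

Lemma act_is_mul_wtop k l m :
  (l < k)%N -> lex_supp k l m -> act_is_mul k l (wtop (mon m)).
Proof.
move=> lk sm; apply: act_is_mulD; first apply: act_is_mulD.
- exact: act_is_mul_col_wtop.
- by apply: act_is_mul_sum => j bj; apply: act_is_mul_xd => // ->.
- apply: act_is_mulN; apply: act_is_mul_sum => j aj.
  by apply: act_is_mul_xd => // ->.
Qed.

(** A term x_{a,j} d_{b,j} can bring in an earlier variable, but then (k,l) lies in row [a] right of
    column [j], or in row [b] with [l <= j], and E_{k,l} commutes with E_{a,j}. A term x_{j,b}
    d_{j,a} moves a variable to the right in its row, so it brings in no earlier one. *)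
Lemma act_is_mul_raising_op k l m :
  (l < k)%N -> lex_supp k l m -> act_is_mul k l (raising_op (mon m)).
Proof.
move=> lk sm; apply: act_is_mulD; first apply: act_is_mulD.
- rewrite d_mon linearZ; apply: act_is_mulZ.
  by apply: act_is_mul_col_wtop => //; apply: lex_suppB.
- apply: act_is_mul_sum => j ja; apply: act_is_mul_xd => //.
  move: ab lk ja; rewrite /lex_le -!val_eqE /= => hi lk' ja le1 le2.
  by apply: e_comm; rewrite -!val_eqE /=; lia.
- apply: act_is_mulN; apply: act_is_mul_sum => j bj; apply: act_is_mul_xd => //.
  move: ab lk bj; rewrite /lex_le -!val_eqE /= => hi lk' bj le1 le2.
  by exfalso; lia.
Qed.

Lemma X_one : X 1 = v.
Proof.
rewrite -mon0 X_mon /ordered_monomial big1 // => j _.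
by apply: big1 => k _; rewrite expo0.
Qed.

(** The scalars in [h_br] and [wtop_xM] agree, so induction from the highest weight vector
    applies. *)
Lemma act_h_mon m : act h (X (mon m)) = X (wtop (mon m)).
Proof.
elim/mpolyX_ind: m => [|k l m lk sm IH].
  rewrite mon0 X_one act_h /wtop /col_wtop.
  rewrite !big1 => [|j _|j _|j _|j _]; try by rewrite d_one mulr0.
  by rewrite !subr0 !addr0 linearZ /= X_one.
have kl : k != l by rewrite -val_eqE /= gtn_eqF.
rewrite -x_mon // wtop_xM // linearD linearZ /=.
rewrite -(act_is_mul_lex_supp lk sm) -(act_is_mul_wtop lk sm) -!actM.
by rewrite h_br // actDl actZl !actM IH.
Qed.

Lemma act_e_ab_mon m : act (e a b) (X (mon m)) = X (raising_op (mon m)).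
Proof.
elim/mpolyX_ind: m => [|k l m lk sm IH].
  rewrite mon0 X_one act_e_ab /raising_op.
  rewrite !big1 => [|j _|j _]; try by rewrite d_one mulr0.
  by rewrite d_one linear0 subr0 addr0 linear0.
have kl : k != l by rewrite -val_eqE /= gtn_eqF.
have anb : a != b by rewrite -val_eqE /= ab ltn_eqF.
rewrite -x_mon // -(act_is_mul_lex_supp lk sm) -actM raising_op_xM // linearD /=.
rewrite -(act_is_mul_raising_op lk sm) -IH -!actM.
rewrite xpair_eqE.
case: (eqVneq b k) => [bk|bk]; case: (eqVneq a l) => [al|al] /=.
(* The bracket is h_i, acting by [wtop]; on the support of [m] this is [col_wtop] minus one Euler
   term, exactly the first two corrections. *)
- subst k l; rewrite e_ab_ba actDl act_h_mon wtop_lex_supp //.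
  rewrite !ltnn scale1r !scale0r addr0 subr0 eq_sym (negPf anb).
  by rewrite sub0r scaleN1r.
(* The bracket is E_{a,l}. All variables of [m] lie in row [b] or below, hence after x_{a,l}. *)
- subst k; have la : (l < a)%N by move: lk al; rewrite -val_eqE /=; lia.
  rewrite la e_br ?(eq_sym l) ?al ?orbT // eqxx (negPf al) scale1r scale0r subr0.
  rewrite actDl; congr (_ + _); rewrite (negPf kl).
  rewrite subrr !scale0r !add0r scale1r subr0.
  apply: act_is_mul_lex_supp => // r s /sm; rewrite /lex_le -!val_eqE /=; lia.
(* The bracket is -E_{k,b}. The derivative d_{b,a} kills [mon m], and the only variable of [m]
   possibly before x_{k,b} is x_{k,a}, whose root vector commutes with E_{k,b}. *)
- subst l; have bltk : (b < k)%N by move: lk bk; rewrite -val_eqE /=; lia.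
  rewrite bltk e_br ?bk ?eqxx // (negPf bk) scale1r !scale0r sub0r.
  rewrite -scaleN1r actDl actZl; congr (_ + _).
  rewrite (d_lex_supp sm) ?mulr0; last first.
    by move: bltk; rewrite /lex_le -!val_eqE /=; lia.
  rewrite scaler0 !add0r scale1r linearN scaleN1r; congr (- _).
  apply: act_is_mul_mon => // r s sr /sm; rewrite /lex_le -!val_eqE /= => h1 h2.
  by apply: e_comm; rewrite -!val_eqE /=; lia.
(* The bracket is 0. A correction could remain only for [l = b]; then [k > b], so x_{b,a} does not
   occur in [m]. *)
- rewrite e_br ?bk // (negPf bk) eq_sym (negPf al) !scale0r !subr0 actDl act0l.
  congr (_ + _); rewrite add0r addr0.
  case: (eqVneq b l) => [bl|_]; last by rewrite scale0r linear0.
  rewrite (d_lex_supp sm) ?mulr0 ?scaler0 ?linear0 //.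
  by subst l; move: lk ab; rewrite /lex_le -!val_eqE /=; lia.
Qed.

End HighestWeightModule.
End WeylCalculus.

(** * Matrix units and Cartan elements in sl(n) *)

Section SlMatrices.
Context (R : realType) (n : nat).
Local Notation C := R[i].

Lemma delta_mx_sl (i j : 'I_n) : i != j -> (delta_mx i j : 'M[C]_n) \in sl R n.
Proof.
move=> ij; rewrite mem_sl /mxtrace big1 // => k _; rewrite mxE.
by case: eqP => // ->; rewrite (negPf ij).
Qed.

Lemma hmx_cartan (i : 'I_n.-1) : hmx R i \in cartan R n.
Proof. by apply: memv_span; apply: map_f; rewrite mem_enum. Qed.

Lemma hmx_sl (i : 'I_n.-1) : hmx R i \in sl R n.
Proof. exact: (subvP (cartan_sub_sl R n)) (hmx_cartan i). Qed.

Lemma hmx_delta_br (i : 'I_n.-1) (k l : 'I_n) :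
  hmx R i *m delta_mx k l - delta_mx k l *m hmx R i =
  ((ord_lo i == k)%:R - (ord_lo i == l)%:R
      - (ord_hi i == k)%:R + (ord_hi i == l)%:R) *: delta_mx k l.
Proof.
have dl a : (delta_mx a l : 'M[C]_n) *+ (a == k) = (a == k)%:R *: delta_mx k l.
  by case: eqVneq => [->|_]; rewrite ?scale1r ?scale0r.
have dr a : (delta_mx k a : 'M[C]_n) *+ (l == a) = (a == l)%:R *: delta_mx k l.
  by rewrite [l == a]eq_sym; case: eqVneq => [->|_]; rewrite ?scale1r ?scale0r.
rewrite /hmx mulmxBl mulmxBr !mul_delta_mx_cond !dl !dr -!scalerBl.
by congr (_ *: _); ring.
Qed.

End SlMatrices.


(** * Commutation relations in U(sl(n)) *)

Section UslRelations.
Context (R : realType) (n : nat).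
Local Notation C := R[i].

Lemma usl_is_linear : linear (@usl R n).
Proof.
move=> t x y; rewrite /usl linearP.
exact: env_inj_is_linear.
Qed.
HB.instance Definition _ :=
  GRing.isLinear.Build C 'M[C]_n (Usl R n) *:%R (@usl R n) usl_is_linear.

Lemma usl_br (x y : 'M[C]_n) : x \in sl R n -> y \in sl R n ->
  usl x * usl y = usl y * usl x + usl (x *m y - y *m x).
Proof.
move=> slx sly; have := env_inj_br (@sl_br R n) (vsproj _ x) (vsproj _ y).
have -> : sl_br (vsproj (sl R n) x) (vsproj _ y)
    = vsproj _ (x *m y - y *m x) by rewrite /sl_br !vsprojK.
move=> E; apply/eqP; rewrite addrC -subr_eq; apply/eqP.
exact: esym E.
Qed.

(** When [j = k] and [l = i], the two diagonal units are not traceless and their classes are junk,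
    but [usl] is linear on all matrices and their difference is traceless. *)
Lemma usl_delta_br (i j k l : 'I_n) : i != j -> k != l ->
  usl (delta_mx i j : 'M[C]_n) * usl (delta_mx k l) =
  usl (delta_mx k l) * usl (delta_mx i j)
   + ((j == k)%:R *: usl (delta_mx i l) - (l == i)%:R *: usl (delta_mx k j)).
Proof.
move=> ij kl; apply: etrans (usl_br (delta_mx_sl R ij) (delta_mx_sl R kl)) _.
have -> : delta_mx i j *m delta_mx k l - delta_mx k l *m delta_mx i j =
    (j == k)%:R *: delta_mx i l - (l == i)%:R *: delta_mx k j :> 'M[C]_n.
  by rewrite !mul_delta_mx_cond !scaler_nat.
congr (_ + _).
apply: etrans (usl_is_linear _ _ _) _; congr (_ + _).
by apply: etrans (raddfN _ _) _; congr (- _); apply: linearZZ.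
Qed.

Lemma usl_hmx_br (i : 'I_n.-1) (k l : 'I_n) : k != l ->
  usl (hmx R i) * usl (delta_mx k l) = usl (delta_mx k l) * usl (hmx R i)
   + ((ord_lo i == k)%:R - (ord_lo i == l)%:R
      - (ord_hi i == k)%:R + (ord_hi i == l)%:R) *: usl (delta_mx k l).
Proof.
move=> kl; apply: etrans (usl_br (hmx_sl R i) (delta_mx_sl R kl)) _.
by rewrite hmx_delta_br; congr (_ + _); apply: linearZZ.
Qed.

End UslRelations.

(** * The raising operators on the Verma module, and the criterion *)

Section VermaAction.
Context (R : realType) (n : nat) (lam : weight R n).
Local Notation C := R[i].
Implicit Types (x y : Usl R n) (u : verma lam).

Lemma verma_pi_surj u : exists y, u = verma_pi lam y.
Proof. by exists (verma_repr u); symmetry; apply: verma_reprK. Qed.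

Lemma verma_act_is_linear x : linear (@verma_act R n lam x).
Proof.
move=> t u w; have [y ->] := verma_pi_surj u; have [z ->] := verma_pi_surj w.
apply: etrans (congr1 (verma_act x) (esym (verma_pi_is_linear lam t y z))) _.
rewrite !verma_actE mulrDr -scalerAr.
exact: verma_pi_is_linear.
Qed.

Lemma verma_act_is_linearl u : linear (@verma_act R n lam ^~ u).
Proof.
move=> t x y /=; have [z ->] := verma_pi_surj u.
rewrite !verma_actE.
rewrite mulrDl -scalerAl.
exact: verma_pi_is_linear.
Qed.

Lemma verma_actM x y u : verma_act (x * y) u = verma_act x (verma_act y u).
Proof. by have [z ->] := verma_pi_surj u; rewrite !verma_actE mulrA. Qed.

Lemma verma_act1 u : verma_act 1 u = u.
Proof. by have [z ->] := verma_pi_surj u; rewrite verma_actE mul1r. Qed.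

Lemma verma_act_hmx i :
  verma_act (usl (hmx R i)) (verma_vec lam) = wt_coord lam i *: verma_vec lam.
Proof.
have := verma_vec_wt lam (vsproj (cartan R n) (hmx R i)).
by rewrite (vsprojK (hmx_cartan R i)).
Qed.

Lemma verma_act_raise (X : {linear polA R n -> verma lam})
    (X_mon : forall m, X 'X_[m] = verma_act (Epow R m) (verma_vec lam))
    (i : 'I_n.-1) (p : polA R n) :
  verma_act (usl (delta_mx (ord_lo i) (ord_hi i))) (X p) = X (dop lam i p).
Proof.
pose d k l : {linear polA R n -> polA R n} := dvar k l.
have dopE q : dop lam i q =
  raising_op (wt_coord lam i) (ord_lo i) (ord_hi i) (@xvar R n) d q by [].
have raise_mon m :
    verma_act (usl (delta_mx (ord_lo i) (ord_hi i))) (X 'X_[m]) =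
    X (dop lam i 'X_[m]).
  rewrite dopE.
  (* With the root vectors [usl (delta_mx k l)] for [e], [ordered_monomial e m] is convertible to
     [Epow R m], so [X_mon] fits. *)
  refine (@act_e_ab_mon n C (polA R n) (wt_coord lam i) (ord_lo i) (ord_hi i)
    (@xvar R n) d _ (fun m => 'X_[m]) _ _ _ _ (Usl R n) (verma lam)
    (@verma_act R n lam) (verma_vec lam) verma_act_is_linear
    verma_act_is_linearl verma_actM _
    (fun k l => usl (delta_mx k l)) (usl (hmx R i)) _ _ _ _ _ X X_mon m).
  - by move=> j0 j1 k l q lk; apply: dvar_xvarM.
  - exact: mpolyX0.
  - by move=> k l m0 lk; apply: xvarX.
  - by move=> k l m0; apply: dvarX.
  - by [].
  - exact: verma_act1.
  - by move=> j0 j1 k l jj kl _; apply: usl_delta_br.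
  - have ab : ord_lo i != ord_hi i by rewrite -val_eqE /= ltn_eqF.
    have ba : ord_hi i != ord_lo i by rewrite eq_sym.
    apply: etrans (usl_delta_br R ab ba) _; congr (_ + _).
    by rewrite !eqxx !scale1r; apply: esym (raddfB (@usl R n) _ _).
  - by move=> k l; apply: usl_hmx_br.
  - exact: verma_vec_pos.
  - exact: verma_act_hmx.
apply: (@mpoly_linear_ext _ _ _
  (fun q => verma_act (usl (delta_mx (ord_lo i) (ord_hi i))) (X q))
  (fun q => X (dop lam i q)) _ _ raise_mon) => t q r.
- by rewrite (linearP X); apply: verma_act_is_linear.
- by rewrite !dopE raising_op_is_linear; apply: linearP.
Qed.

End VermaAction.

Theorem proposition2p1 (R : realType) (n : nat) (n_ge2 : (2 <= n)%N)
    (lam : weight R n) (tau : {linear verma lam -> polA R n})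
    (tau_bij : bijective tau)
    (tauE : forall alpha,
       tau (verma_act (Epow R alpha) (verma_vec lam)) = xpow R alpha)
    (u : verma lam) (u_neq0 : u != 0) (u_homo : homogeneous u) :
  singular u <-> forall i : 'I_n.-1, dop lam i (tau u) = 0.
Proof.
have [X tauK XK] := tau_bij.
pose Xlin : {linear polA R n -> verma lam} := HB.pack X
  (GRing.isLinear.Build _ _ _ _ X (can2_linear tauK XK)).
(* [tauE] determines the inverse of [tau] on monomials, since [xpow] is the monomial itself. *)
have X_mon m : Xlin 'X_[m] = verma_act (Epow R m) (verma_vec lam).
  by apply: (can_inj tauK); rewrite tauE xpowE; apply: XK.
have act_u i : verma_act (usl (delta_mx (ord_lo i) (ord_hi i))) u =
    X (dop lam i (tau u)).
  by rewrite -{1}[u]tauK; apply: (verma_act_raise X_mon).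
have X0 : X 0 = 0 by apply: (can_inj tauK); rewrite XK; apply/esym/linear0.
(* As [X] is linear and injective, [act_u] makes the vanishing of E_{i,i+1} u equivalent to that of
   d_i(tau u). *)
split=> [[_ _ sing] i|dop0].
  by apply: (can_inj XK); rewrite X0 -act_u.
by split=> // i; rewrite act_u dop0.
Qed.
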